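(* A ring homomorphism $\phi\colon A\to B$ is radical-preserving in each of the following cases: (i) $\phi$ is surjective. (ii) The Jacobson radical of $A$ is nil and $B$ is basic semiperfect.
   Context: Rings are associative with unit, and homomorphisms are unital. $J(R)$ is the Jacobson radical of $R$. $\phi$ is radical-preserving if $\phi(J(A))\subseteq J(B)$. A subset of a ring is nil if all its elements are nilpotent. A ring $R$ is semiperfect if $R/J(R)$ is semisimple and idempotents lift modulo $J(R)$. A semiperfect ring $R$ is basic if for a complete set $\{e_i\}_{i}$ of primitive orthogonal idempotents of $R$ (finite, pairwise orthogonal, each $Re_i$ indecomposable, $\sum_i e_i=1$) the left modules $Re_i$ are pairwise non-isomorphic. *)

(* Defs.v *)
From HB Require Import structures.
From mathcomp Require Import all_boot all_order all_algebra.
From mathcomp Require Import boolp.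

Set Implicit Arguments.
Unset Strict Implicit.
Unset Printing Implicit Defensive.

Import GRing.Theory.
Import Quotient.
Local Open Scope ring_scope.
Local Open Scope quotient_scope.

(* All rings are [pzRingType]s, so the zero ring is allowed. Subsets are boolean
   predicates; by [boolp.asbool] every propositional subset is of this form.
   A left ideal of R is a submodule of the left regular module R^o. *)

Section Modules.
Variable R : pzRingType.
Implicit Types U V : lmodType R.

(* V is the internal direct sum of the submodules N and P. *)
Definition module_direct_sum V (N P : {pred V}) : Prop :=
  [/\ submod_closed N, submod_closed P,
      forall x, exists y z, [/\ y \in N, z \in P & x = y + z]
    & forall x, x \in N -> x \in P -> x = 0].

Definition semisimple_module V : Prop :=
  forall N : {pred V}, submod_closed N -> exists P, module_direct_sum N P.

Definition indecomposable_module V : Prop :=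
  (exists x : V, x != 0) /\
  (forall N P : {pred V}, module_direct_sum N P ->
     (forall x, x \in N -> x = 0) \/ (forall x, x \in P -> x = 0)).

Definition isomorphic_modules U V : Prop :=
  exists f : {linear U -> V}, bijective f.

End Modules.

Definition semisimple_ring (R : pzRingType) : Prop := semisimple_module R^o.

Section PrincipalLeftIdeal.
Variables (R : pzRingType) (e : R).

Definition left_principal : {pred R^o} :=
  fun x => `[< exists r : R, x = r * e >].

Lemma left_principal_submod_closed : submod_closed left_principal.
Proof.
split=> [|a x y /asboolP[r ->] /asboolP[s ->]]; apply/asboolP.
  by exists 0; rewrite mul0r.
by exists (a * r + s); rewrite mulrDl -mulrA.
Qed.

HB.instance Definition _ :=
  GRing.isSubmodClosed.Build R R^o left_principal left_principal_submod_closed.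

(* The left module Re. *)
Record principal_module : Type := PrincipalModule {
  principal_val : R^o;
  _ : principal_val \in left_principal
}.

HB.instance Definition _ := [isSub for principal_val].
HB.instance Definition _ := [Choice of principal_module by <:].
HB.instance Definition _ := [SubChoice_isSubLmodule of principal_module by <:].

End PrincipalLeftIdeal.

Section Jacobson.
Variable R : pzRingType.

Definition maximal_left_ideal (M : {pred R^o}) : Prop :=
  [/\ submod_closed M, 1 \notin M
    & forall N : {pred R^o}, submod_closed N -> 1 \notin N ->
        {subset M <= N} -> {subset N <= M}].

Definition jacobson : {pred R} :=
  fun x => `[< forall M, maximal_left_ideal M -> x \in M >].

Lemma jacobson_submod_closed : submod_closed (jacobson : {pred R^o}).
Proof.
split=> [|a x y /asboolP Jx /asboolP Jy]; apply/asboolP => M maxM.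
  by case: maxM => -[].
by have [[_ linM] _ _] := maxM; apply: linM; [apply: Jx | apply: Jy].
Qed.

Lemma jacobson_mull a x : x \in jacobson -> a * x \in jacobson.
Proof.
have [J0 linJ] := jacobson_submod_closed.
by move=> Jx; have := linJ a x 0 Jx J0; rewrite addr0.
Qed.

Lemma jacobson_mulr x a : x \in jacobson -> x * a \in jacobson.
Proof.
move=> /asboolP Jx; apply/asboolP => M maxM.
have [[M0 linM] M1 maM] := maxM.
have ZM b y : y \in M -> b * y \in M.
  by move=> My; have := linM b y 0 My M0; rewrite addr0.
have DM y z : y \in M -> z \in M -> y + z \in M.
  by move=> My Mz; have := linM 1 y z My Mz; rewrite scale1r.
have [Ma|nMa] := boolP ((a : R^o) \in M); first exact: ZM.
pose Q : {pred R^o} := fun y => (y * a : R^o) \in M.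
suff maxQ : maximal_left_ideal Q by have := Jx Q maxQ; rewrite unfold_in.
split; first split.
- by rewrite unfold_in /Q mul0r.
- move=> b y z; rewrite !unfold_in /Q => My Mz.
  by rewrite mulrDl; apply: DM => //; rewrite -mulrA; apply: ZM.
- by rewrite unfold_in /Q mul1r.
move=> N [N0 linN] N1 sQN y Ny; rewrite unfold_in /Q; apply/negPn/negP => nMy.
pose P : {pred R^o} := fun z => `[< exists m s, m \in M /\ z = m + s * (y * a) >].
have sMP : {subset M <= P}.
  by move=> m Mm; apply/asboolP; exists m, 0; rewrite mul0r addr0.
have subP : submod_closed P.
  split=> [|b u v /asboolP[m [s [Mm ->]]] /asboolP[m' [s' [Mm' ->]]]].
    exact: sMP.
  apply/asboolP; exists (b * m + m'), (b * s + s'); split; first exact: linM.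
  by rewrite -[_ *: _]/(b * (m + s * (y * a))) mulrDr mulrDl -(mulrA b) addrACA.
have [P1|nP1] := boolP ((1 : R^o) \in P); last first.
  case/negP: nMy; apply: (maM P subP nP1 sMP).
  by apply/asboolP; exists 0, 1; rewrite add0r mul1r.
have /asboolP [m [s [Mm am]]] : (a : R^o) \in P.
  by have := subP.2 a 1 0 P1 subP.1; rewrite addr0 [_ *: _]mulr1.
have Qs : (1 - s * y : R^o) \in Q.
  by rewrite unfold_in /Q mulrBl mul1r {1}am -mulrA addrK.
case/negP: N1; have := linN s y _ Ny (sQN _ Qs).
by rewrite addrC subrK.
Qed.

Lemma jacobson_zmod_closed : zmod_closed jacobson.
Proof. exact: GRing.submod_closedB jacobson_submod_closed. Qed.

HB.instance Definition _ :=
  GRing.isZmodClosed.Build R jacobson jacobson_zmod_closed.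

End Jacobson.
Arguments jacobson : clear implicits.

Section JacobsonQuotient.
Variable R : pzRingType.

(* The ring R / J(R). *)
Definition jquot : Type := {quot (jacobson R)}.

HB.instance Definition _ := GRing.Zmodule.on jquot.

Definition jpi (x : R) : jquot := \pi_({quot (jacobson R)}) x.

Lemma jpiP x y : jpi x = jpi y <-> x - y \in jacobson R.
Proof. by rewrite idealrBE; exact: (rwP eqP). Qed.

Definition jquot_one : jquot := jpi 1.
Definition jquot_mul (u v : jquot) : jquot := jpi (repr u * repr v).

Lemma jpi_repr (u : jquot) : jpi (repr u) = u.
Proof. exact: reprK. Qed.

Lemma jpiB : zmod_morphism jpi.
Proof. by move=> x y; rewrite /jpi; apply: pi_is_zmod_morphism. Qed.

Lemma jpiM x y : jpi (x * y) = jquot_mul (jpi x) (jpi y).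
Proof.
apply/jpiP; set x' := repr _; set y' := repr _.
have Jx : x - x' \in jacobson R by apply/jpiP; rewrite jpi_repr.
have Jy : y - y' \in jacobson R by apply/jpiP; rewrite jpi_repr.
rewrite (_ : _ - _ = (x - x') * y + x' * (y - y')).
  by apply: rpredD; [apply: jacobson_mulr | apply: jacobson_mull].
by rewrite mulrBl mulrBr addrA subrK.
Qed.

HB.instance Definition _ := GRing.isZmodMorphism.Build R jquot jpi jpiB.

Lemma jquot_mulA : associative jquot_mul.
Proof.
move=> u v w; rewrite -[u]jpi_repr -[v]jpi_repr -[w]jpi_repr.
by rewrite -!jpiM mulrA.
Qed.

Lemma jquot_mul1l : left_id jquot_one jquot_mul.
Proof. by move=> u; rewrite -[u]jpi_repr -jpiM mul1r. Qed.

Lemma jquot_mul1r : right_id jquot_one jquot_mul.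
Proof. by move=> u; rewrite -[u]jpi_repr -jpiM mulr1. Qed.

Lemma jquot_mulDl : left_distributive jquot_mul +%R.
Proof.
move=> u v w; rewrite -[u]jpi_repr -[v]jpi_repr -[w]jpi_repr.
by rewrite -raddfD -!jpiM mulrDl raddfD.
Qed.

Lemma jquot_mulDr : right_distributive jquot_mul +%R.
Proof.
move=> u v w; rewrite -[u]jpi_repr -[v]jpi_repr -[w]jpi_repr.
by rewrite -raddfD -!jpiM mulrDr raddfD.
Qed.

HB.instance Definition _ := GRing.Zmodule_isPzRing.Build jquot
  jquot_mulA jquot_mul1l jquot_mul1r jquot_mulDl jquot_mulDr.

Lemma jpi_monoid_morphism : monoid_morphism jpi.
Proof. by split=> // x y; rewrite jpiM. Qed.

HB.instance Definition _ :=
  GRing.isMonoidMorphism.Build R jquot jpi jpi_monoid_morphism.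

End JacobsonQuotient.

Section RingProperties.
Variable R : pzRingType.

Definition nil_subset (X : {pred R}) : Prop :=
  forall x, x \in X -> exists n : nat, x ^+ n = 0.

Definition idempotents_lift_mod_jacobson : Prop :=
  forall f : jquot R, f * f = f -> exists2 e : R, e * e = e & jpi e = f.

Definition semiperfect : Prop :=
  semisimple_ring (jquot R) /\ idempotents_lift_mod_jacobson.

Definition complete_primitive_orthogonal n (e : 'I_n -> R) : Prop :=
  [/\ forall i, e i * e i = e i,
      forall i j, i != j -> e i * e j = 0,
      forall i, indecomposable_module (principal_module (e i))
    & \sum_i e i = 1].

(* In a semiperfect ring complete sets of primitive orthogonal idempotents exist
   and are unique up to conjugation, so "some" and "every" such set agree here. *)
Definition basic_semiperfect : Prop :=
  semiperfect /\
  exists n (e : 'I_n -> R), complete_primitive_orthogonal e /\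
    forall i j, i != j ->
      ~ isomorphic_modules (principal_module (e i)) (principal_module (e j)).

End RingProperties.

Definition radical_preserving (A B : pzRingType) (phi : {rmorphism A -> B}) : Prop :=
  forall x, x \in jacobson A -> phi x \in jacobson B.

(* Main.v *)
Require Import Defs.
From mathcomp Require Import all_boot all_order all_algebra.
From HB Require Import structures.
From mathcomp Require Import boolp.
From mathcomp Require classical_sets.
Local Open Scope ring_scope.

Set Implicit Arguments.
Unset Strict Implicit.
Unset Printing Implicit Defensive.

Import GRing.Theory.

(** A ring map phi pulls left ideals back to left ideals. When phi is onto, the
    inverse image of a maximal left ideal is again maximal, because the left
    ideals of B are those of A that contain the kernel. So an element of every
    maximal left ideal of A is sent into every maximal left ideal of B.

    In the second case, phi maps J(A) to nilpotent elements, so it is enough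
    that J(B) contains every nilpotent of B
    ([basic_semiperfect_nilpotent_jacobson]), that is, that S = B/J(B) is
    reduced. Morally, S is a product of division rings: S is semisimple, and a
    basic ring has no repeated simple factor. Concretely, let e_i be the
    primitive idempotents of B and f_i their images in S.
    - Idempotents of f_i S f_i lift to e_i B e_i ([lift_corner_idempotent]),
      where there are only 0 and e_i ([indecomposable_primitive]). As S is von
      Neumann regular, each nonzero x in S f_i generates S f_i
      ([primitive_corner_left_inverse]): S f_i is simple.
    - A nonzero element of f_i S f_j would be an isomorphism between S f_i and
      S f_j ([corner_two_sided_inverse]). It would lift to an isomorphism
      between B e_i and B e_j ([isomorphic_mod_jacobson]), since elements that
      are 1 modulo J(B) are units ([jacobson_unit]). For i and j distinct this
      contradicts that B is basic, so f_i S f_j = 0.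
    - The f_i are then central with sum 1, and a nonzero element of S f_i is
      left invertible in it, hence not nilpotent
      ([orthogonal_corners_reduced]). *)

(** * Units modulo the Jacobson radical *)

(** Zorn's lemma on the proper left ideals that contain L; a union of a nonempty
    chain of proper left ideals is proper because it omits 1. *)
Lemma exists_maximal_left_ideal (R : pzRingType) (L : {pred R^o}) :
  submod_closed L -> 1 \notin L ->
  exists2 M : {pred R^o}, maximal_left_ideal M & {subset L <= M}.
Proof.
move=> subL L1.
pose T := {N : {pred R^o} | [/\ submod_closed N, 1 \notin N & {subset L <= N}]}.
pose le (N P : T) := `[< {subset sval N <= sval P} >].
pose L' : T := exist _ L (And3 subL L1 (fun x Lx => Lx)).
have [|||[M [subM M1 sLM]] maxM] := @classical_sets.ZL_preorder T L' le.
- by move=> N; apply/asboolP.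
- move=> P N Q /asboolP sNP /asboolP sPQ.
  by apply/asboolP => x /sNP /sPQ.
- move=> A totA; have [[N0 AN0]|noA] := pselect (exists N, A N); last first.
    by exists L' => N AN; case: noA; exists N.
  pose U : {pred R^o} := fun x => `[< exists2 N : T, A N & x \in sval N >].
  have subU : submod_closed U.
    split=> [|a x y /asboolP[N AN Nx] /asboolP[P AP Py]].
      by apply/asboolP; exists N0 => //; case: (svalP N0) => -[].
    have [NP|PN] : le N P \/ le P N by exact: totA.
      move/asboolP: NP => NP.
      apply/asboolP; exists P => //; have [[_ linP] _ _] := svalP P.
      by apply: linP => //; apply: NP.
    move/asboolP: PN => PN.
    apply/asboolP; exists N => //; have [[_ linN] _ _] := svalP N.
    by apply: linN => //; apply: PN.
  have U1 : 1 \notin U.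
    by apply/negP => /asboolP[N _]; apply/negP; case: (svalP N).
  have sLU : {subset L <= U}.
    by move=> x Lx; apply/asboolP; exists N0 => //;
      case: (svalP N0) => _ _; apply.
  exists (exist _ U (And3 subU U1 sLU)) => N AN; apply/asboolP => x Nx.
  by apply/asboolP; exists N.
exists M => //; split=> // N subN N1 sMN.
have sLN : {subset L <= N} by move=> x /sLM /sMN.
have /asboolP := maxM (exist _ N (And3 subN N1 sLN)) (introT (asboolP _) sMN).
by apply.
Qed.

Section JacobsonUnits.
Variable R : pzRingType.
Implicit Types x y : R.

(** If R (1 - x) were proper, a maximal left ideal containing it would also
    contain x, hence 1. *)
Lemma jacobson_left_inverse x :
  x \in jacobson R -> exists y, y * (1 - x) = 1.
Proof.
move=> Jx; apply: contrapT => noinv.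
have [||M maxM sLM] := @exists_maximal_left_ideal R (left_principal (1 - x)).
- exact: left_principal_submod_closed.
- by apply/negP => /asboolP[y y1]; apply: noinv; exists y.
have [[M0 linM] /negP[]] := maxM.
have Mx : (x : R^o) \in M by move/asboolP: Jx; apply.
have M1x : (1 - x : R^o) \in M.
  by apply: sLM; apply/asboolP; exists 1; rewrite mul1r.
by have := linM 1 _ _ M1x Mx; rewrite scale1r subrK.
Qed.

(** The left inverse y satisfies y = 1 + y x with y x in J(R), so y has a left
    inverse z as well, and z = 1 - x. *)
Lemma jacobson_unit x :
  x \in jacobson R -> exists2 y, y * (1 - x) = 1 & (1 - x) * y = 1.
Proof.
move=> Jx; have [y y1] := jacobson_left_inverse Jx.
have Jyx : - (y * x) \in jacobson R by rewrite rpredN jacobson_mull.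
have [z] := jacobson_left_inverse Jyx.
have -> : 1 - - (y * x) = y by rewrite opprK -{1}y1 mulrBr mulr1 subrK.
move=> zy; exists y => //.
by rewrite -[1 - x]mul1r -{1}zy -(mulrA z) y1 mulr1.
Qed.

End JacobsonUnits.

(** * Primitive idempotents in von Neumann regular rings *)

Section PrimitiveCorners.
Variable R : pzRingType.

(** Let P be a complement of R x and write 1 = r x + p with p in P. Then
    x p = x - x r x lies in both R x and P. *)
Lemma semisimple_regular : semisimple_ring R ->
  forall x : R, exists r, x * (r * x) = x.
Proof.
move=> ssR x.
have [P [_ [P0 linP] sumP dirP]] := ssR _ (left_principal_submod_closed x).
have [y [p [/asboolP[r ->] Pp e1]]] := sumP 1.
have xe : x = x * (r * x) + x * p by rewrite -mulrDr -e1 mulr1.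
exists r; rewrite {3}xe [x * p]dirP ?addr0 //.
  apply/asboolP; exists (1 - x * r).
  by rewrite mulrBl mul1r {2}xe -mulrA addrC addKr.
by have := linP x p 0 Pp P0; rewrite addr0.
Qed.

(** If x = x r x, then f = r x is an idempotent generating R x, and e f is an
    idempotent of eRe. It is not 0, since f = f (e f). Hence e f = e, and e lies
    in R x: every nonzero left ideal inside R e is R e. *)
Lemma primitive_corner_left_inverse (e : R) :
  (forall x : R, exists r, x * (r * x) = x) ->
  (forall f, e * f = f -> f * e = f -> f * f = f -> f = 0 \/ f = e) ->
  e * e = e ->
  forall x, x * e = x -> x != 0 -> exists r, r * x = e.
Proof.
move=> regR prim ee x xe x0; have [r xrx] := regR x.
pose f := r * x.
have ff : f * f = f by rewrite /f -mulrA xrx.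
have fe : f * e = f by rewrite /f -mulrA xe.
have [|||ef0|efe] := prim (e * f).
- by rewrite mulrA ee.
- by rewrite -mulrA fe.
- by rewrite mulrA -(mulrA e f e) fe -mulrA ff.
- have f0 : f = 0 by rewrite -ff -{1}fe -mulrA ef0 mulr0.
  by rewrite -xrx -/f f0 mulr0 eqxx in x0.
by exists (e * r); rewrite -mulrA.
Qed.

(** Schur's lemma for the simple left ideals Re and Rf, written with elements:
    a nonzero map Re -> Rf is right multiplication by some w in eRf, and its
    inverse is right multiplication by r. A left inverse s of r exists for the
    same reason that r exists; cut down to eRf, it equals w by associativity. *)
Lemma corner_two_sided_inverse (e f w : R) :
  e * e = e -> f * f = f -> e * w = w -> w * f = w -> w != 0 ->
  (forall x, x * e = x -> x != 0 -> exists r, r * x = e) ->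
  (forall x, x * f = x -> x != 0 -> exists r, r * x = f) ->
  exists r, [/\ f * r = r, r * e = r, r * w = f & w * r = e].
Proof.
move=> ee ff ew wf w0 inv_e inv_f.
have [r0 r0w] := inv_f w wf w0.
pose r := f * r0 * e.
have rw : r * w = f by rewrite /r -!mulrA ew r0w ff.
have re : r * e = r by rewrite /r -!mulrA ee.
have fr : f * r = r by rewrite /r !mulrA ff.
have r_neq0 : r != 0.
  by apply: contraNneq w0 => r0'; rewrite -wf -rw r0' mul0r mulr0.
have [s sr] := inv_e r re r_neq0.
have w_eq : e * (s * f) = w by rewrite -rw (mulrA s) sr mulrA ee.
by exists r; split=> //; rewrite -w_eq -!mulrA fr sr ee.
Qed.

(** The corner conditions make each e_i central, so the ring is the product of
    the rings e_i R, and in e_i R every nonzero element is invertible. *)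
Lemma orthogonal_corners_reduced n (e : 'I_n -> R) :
  \sum_i e i = 1 -> (forall i, e i * e i = e i) ->
  (forall i j x, i != j -> e i * x * e j = 0) ->
  (forall i x, x * e i = x -> x != 0 -> exists r, r * x = e i) ->
  forall (x : R) k, x ^+ k = 0 -> x = 0.
Proof.
move=> e1 ee orth inv x k xk.
have central i y : e i * y = y * e i.
  have -> : e i * y = e i * y * e i.
    rewrite -[LHS]mulr1 -e1 mulr_sumr (bigD1 i) //= big1 ?addr0 // => j ji.
    by rewrite orth // eq_sym.
  rewrite -[RHS]mul1r -e1 mulr_suml (bigD1 i) //= big1 ?addr0 ?mulrA // => j ji.
  by rewrite mulrA orth.
(* If x * e i were nonzero, x would have a left inverse in the i-th component,
   and the k copies of x could be cancelled one by one from x ^+ k * e i = 0. *)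
suff xe i : x * e i = 0 by rewrite -[x]mulr1 -e1 mulr_sumr big1.
apply/eqP/negPn/negP => xe0.
have [|r rxe] := inv i _ _ xe0; first by rewrite -mulrA ee.
suff ei0 : e i = 0 by rewrite ei0 mulr0 eqxx in xe0.
have : x ^+ k * e i = 0 by rewrite xk mul0r.
elim: k {xk} => [|k IH]; first by rewrite mul1r.
rewrite exprS -mulrA -central => /(congr1 ( *%R r)).
by rewrite mulr0 !mulrA -(mulrA r) rxe central; exact: IH.
Qed.

End PrimitiveCorners.

(** * The modules Re and their homomorphisms *)

Section PrincipalModules.
Variable R : pzRingType.
Implicit Types e f x y : R.

Lemma principal_val_mulr e (u : principal_module e) :
  e * e = e -> (val u : R) * e = val u.
Proof. by move=> ee; have /asboolP[r ->] := valP u; rewrite -mulrA ee. Qed.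

Lemma right_mul_subproof e f x (xf : x * f = x) (u : principal_module e) :
  ((val u : R) * x : R^o) \in left_principal f.
Proof. by apply/asboolP; exists ((val u : R) * x); rewrite -mulrA xf. Qed.

Definition right_mul e f x (xf : x * f = x) (u : principal_module e) :
  principal_module f := PrincipalModule (right_mul_subproof xf u).

Lemma right_mul_linear e f x (xf : x * f = x) : linear (@right_mul e f x xf).
Proof. by move=> a u v; apply: val_inj; rewrite /= mulrDl -mulrA. Qed.

HB.instance Definition _ e f x (xf : x * f = x) :=
  GRing.isLinear.Build R (principal_module e) (principal_module f) _
    (@right_mul e f x xf) (@right_mul_linear e f x xf).

(** Right multiplication by x is the isomorphism. The composites Re -> Rf -> Re
    and Rf -> Re -> Rf are right multiplications by x y and y x, which agree on
    Re and Rf with right multiplication by units of R congruent to 1 modulo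
    J(R). *)
Lemma isomorphic_mod_jacobson e f x y :
  e * e = e -> f * f = f -> x * f = x -> e * x = x -> y * e = y -> f * y = y ->
  e - x * y \in jacobson R -> f - y * x \in jacobson R ->
  isomorphic_modules (principal_module e) (principal_module f).
Proof.
move=> ee ff xf ex ye fy Je Jf; exists (right_mul xf).
have [u _ u1] := jacobson_unit Je; have [v v1 _] := jacobson_unit Jf.
have inj : injective (@right_mul e f x xf).
  move=> a b /(congr1 val) /= abx; apply: val_inj.
  rewrite -[val a](principal_val_mulr _ ee) -[val b](principal_val_mulr _ ee).
  have exy : e * (1 - (e - x * y)) = x * y.
    by rewrite mulrBr mulr1 mulrBr ee mulrA ex opprB addrC subrK.
  have e_inv : e = x * y * u by rewrite -exy -mulrA u1 mulr1.
  move: abx; rewrite /=; move: (principal_val a) (principal_val b) => r s rs.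
  by rewrite e_inv !mulrA rs.
have surj (c : principal_module f) :
    exists a : principal_module e, right_mul xf a = c.
  have yxf : (1 - (f - y * x)) * f = y * x.
    by rewrite mulrBl mul1r mulrBl ff -mulrA xf opprB addrC subrK.
  have f_inv : f = v * y * x by rewrite -mulrA -yxf mulrA v1 mul1r.
  have Rey : ((val c : R) * (v * y) : R^o) \in left_principal e.
    by apply/asboolP; exists ((val c : R) * (v * y)); rewrite -!mulrA ye.
  exists (PrincipalModule Rey); apply: val_inj => /=.
  rewrite -[RHS](principal_val_mulr c ff).
  by rewrite /=; move: (principal_val c) => r; rewrite -mulrA -f_inv.
have [g gK] := choice surj.
by exists g => // a; apply: inj; rewrite gK.
Qed.

(** An idempotent g of eRe splits Re as R (e - g) + R g. The two summands are
    encoded as the annihilators in Re of g and of e - g. *)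
Lemma indecomposable_primitive e : e * e = e ->
  indecomposable_module (principal_module e) ->
  forall g, e * g = g -> g * e = g -> g * g = g -> g = 0 \/ g = e.
Proof.
move=> ee [_ indec] g eg ge gg.
pose N h : {pred principal_module e} := fun u => (val u : R) * h == 0.
have subN h : submod_closed (N h).
  split=> [|a u v /eqP Nu /eqP Nv]; apply/eqP; first by rewrite mul0r.
  by rewrite /= mulrDl -mulrA Nu Nv mulr0 addr0.
have Rg : (g : R^o) \in left_principal e by apply/asboolP; exists g.
have Reg : (e - g : R^o) \in left_principal e.
  by apply/asboolP; exists (e - g); rewrite mulrBl ee ge.
have [|Ng|Neg] := indec (N g) (N (e - g)).
- split=> // [u|u /eqP ug /eqP].
    have Ru h : h \in left_principal e ->
        ((val u : R) * h : R^o) \in left_principal e.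
      move=> /asboolP[r ->]; apply/asboolP.
      by exists ((val u : R) * r); rewrite mulrA.
    exists (PrincipalModule (Ru _ Reg)), (PrincipalModule (Ru _ Rg)); split.
    - by apply/eqP; rewrite /= -mulrA mulrBl eg gg subrr mulr0.
    - by apply/eqP; rewrite /= -mulrA mulrBr ge gg subrr mulr0.
    by apply: val_inj; rewrite /= -mulrDr subrK principal_val_mulr.
  rewrite mulrBr ug subr0 principal_val_mulr // => u0.
  exact: val_inj.
- right; have Ne : PrincipalModule Reg \in N g.
    by apply/eqP; rewrite /= mulrBl eg gg subrr.
  by apply/esym/eqP; rewrite -subr_eq0; apply/eqP/(congr1 val (Ng _ Ne)).
left; have Ne : PrincipalModule Rg \in N (e - g).
  by apply/eqP; rewrite /= mulrBr ge gg subrr.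
exact: (congr1 val (Neg _ Ne)).
Qed.

End PrincipalModules.

(** * Reduction modulo the Jacobson radical *)

Section Quotient.
Variable R : pzRingType.

Lemma jpi_eq0 (x : R) : jpi x = 0 <-> x \in jacobson R.
Proof. by rewrite -(raddf0 (@jpi R)) jpiP subr0. Qed.

(** A lift g of f need not lie in eRe, but g = g e modulo J(R). Hence
    u = 1 - g (1 - e) is a unit congruent to 1, with g u = g e. The conjugate
    a = u^-1 g u is still a lift of f and satisfies a e = a. Then e a is an
    idempotent of eRe, because a (e a) = a. *)
Lemma lift_corner_idempotent (e : R) (f : jquot R) :
  idempotents_lift_mod_jacobson R -> e * e = e ->
  jpi e * f = f -> f * jpi e = f -> f * f = f ->
  exists g, [/\ e * g = g, g * e = g, g * g = g & jpi g = f].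
Proof.
move=> lift ee ef fe ff; have [g gg gf] := lift f ff.
have Jg : g * (1 - e) \in jacobson R.
  by apply/jpi_eq0; rewrite rmorphM rmorphB rmorph1 /= gf mulrBr mulr1 fe subrr.
have [v] := jacobson_unit Jg; set u := 1 - _ => vu uv.
have gu : g * u = g * e.
  by rewrite /u mulrBr mulr1 mulrA gg mulrBr mulr1 opprB addrC subrK.
have ju : jpi u = 1 by rewrite rmorphB rmorph1 /= (proj2 (jpi_eq0 _) Jg) subr0.
have jv : jpi v = 1.
  by rewrite -[LHS]mulr1 -ju -rmorphM vu rmorph1.
pose a := v * (g * u).
have ae : a * e = a by rewrite /a gu -!mulrA ee.
have aa : a * a = a.
  by rewrite /a -!mulrA (mulrA u) uv mul1r (mulrA g) gg.
have ja : jpi a = f by rewrite !rmorphM /= ju jv gf mul1r mulr1.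
exists (e * a); split.
- by rewrite mulrA ee.
- by rewrite -mulrA ae.
- by rewrite mulrA -(mulrA e a e) ae -mulrA aa.
by rewrite rmorphM /= ja.
Qed.

Lemma basic_semiperfect_nilpotent_jacobson (x : R) k :
  basic_semiperfect R -> x ^+ k = 0 -> x \in jacobson R.
Proof.
case=> [[ss lift] [n [e [[ee _ indec e1] noniso]]]] xk; apply/jpi_eq0.
have jee i : jpi (e i) * jpi (e i) = jpi (e i) by rewrite -rmorphM ee.
have inv i (y : jquot R) : y * jpi (e i) = y -> y != 0 ->
    exists r, r * y = jpi (e i).
  apply: primitive_corner_left_inverse; first exact: semisimple_regular.
    move=> f ef fe ff.
    have [g [eg ge gg <-]] := lift_corner_idempotent lift (ee i) ef fe ff.
    have [->|->] := indecomposable_primitive (ee i) (indec i) eg ge gg.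
      by left; rewrite raddf0.
    by right.
  exact: jee.
apply: (@orthogonal_corners_reduced (jquot R) n
  (fun i => jpi (e i)) _ _ _ _ (jpi x) k) => //.
- by rewrite -rmorph_sum e1 rmorph1.
- move=> i j z ij; apply/eqP/negPn/negP.
  set w := _ * jpi (e j) => w0.
  have ew : jpi (e i) * w = w by rewrite /w !mulrA jee.
  have we : w * jpi (e j) = w by rewrite /w -!mulrA jee.
  have [r [er re rw wr]] :=
    corner_two_sided_inverse (jee i) (jee j) ew we w0 (inv i) (inv j).
  apply: (noniso i j ij).
  (* Representatives of w and r, cut down to the corners of R. *)
  pose X := e i * repr w * e j; pose Y := e j * repr r * e i.
  have jX : jpi X = w by rewrite !rmorphM /= jpi_repr ew.
  have jY : jpi Y = r by rewrite !rmorphM /= jpi_repr er.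
  apply: (@isomorphic_mod_jacobson R (e i) (e j) X Y) => //.
  - by rewrite /X -!mulrA ee.
  - by rewrite /X !mulrA ee.
  - by rewrite /Y -!mulrA ee.
  - by rewrite /Y !mulrA ee.
  - by apply/jpi_eq0; rewrite rmorphB rmorphM /= jX jY wr subrr.
  by apply/jpi_eq0; rewrite rmorphB rmorphM /= jX jY rw subrr.
by rewrite -(rmorphXn (@jpi R)) xk raddf0.
Qed.

End Quotient.

(** * Radical-preserving homomorphisms *)

Lemma surjective_radical_preserving (A B : pzRingType)
    (phi : {rmorphism A -> B}) :
  (forall y : B, exists x : A, phi x = y) -> radical_preserving phi.
Proof.
move=> surj x /asboolP Jx; apply/asboolP => M [subM M1 maxM].
have [M0 linM] := subM.
pose P : {pred A^o} := fun a => (phi a : B^o) \in M.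
suff maxP : maximal_left_ideal P by exact: (Jx P maxP).
split.
- split=> [|a u v Pu Pv]; first by rewrite unfold_in /P rmorph0.
  by rewrite unfold_in /P rmorphD rmorphM; apply: linM.
- by rewrite unfold_in /P rmorph1.
move=> N [N0 linN] N1 sPN a Na.
pose Q : {pred B^o} := fun b => `[< exists2 c, (c : A^o) \in N & phi c = b >].
apply: (maxM Q).
- split=> [|b u v /asboolP[c Nc <-] /asboolP[d Nd <-]]; apply/asboolP.
    by exists 0; rewrite ?rmorph0.
  have [b' <-] := surj b; exists (b' * c + d); first exact: linN.
  by rewrite rmorphD rmorphM.
(* N contains the kernel of phi, so if 1 is the image of c in N, then
   1 - c is also in N. *)
- apply: contra N1 => /asboolP[c Nc c1].
  have N1c : (1 - c : A^o) \in N.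
    by apply: sPN; rewrite unfold_in /P rmorphB rmorph1 c1 subrr.
  by have := linN 1 _ _ N1c Nc; rewrite scale1r subrK.
- move=> b Mb; apply/asboolP; have [c cb] := surj b; exists c => //.
  by apply: sPN; rewrite unfold_in /P cb.
by apply/asboolP; exists a.
Qed.

Theorem proposition3p14 (A B : pzRingType) (phi : {rmorphism A -> B}) :
  ((forall y : B, exists x : A, phi x = y) -> radical_preserving phi) /\
  (nil_subset (jacobson A) -> basic_semiperfect B -> radical_preserving phi).
Proof.
split; first exact: surjective_radical_preserving.
move=> nilJ basicB x Jx; have [k xk] := nilJ x Jx.
apply: (@basic_semiperfect_nilpotent_jacobson B (phi x) k basicB).
by rewrite -rmorphXn xk rmorph0.
Qed.
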